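(* Let $\Gamma$ be a metrized graph with vertex set $V(\Gamma)$ and edge set $E(\Gamma)$, and let $r$ be its resistance function. Let $e_i \in E(\Gamma)$ be an edge of length $L_i$ with end points $p_i$ and $q_i$. If $x$ belongs to the edge $e_i$, then for any vertex $p \in V(\Gamma)$ we have $$r(p,x)= -x^2\, \frac{L_i - r(p_i,q_i)}{L_i^2}+x\, \frac{L_i-r(p_i,q_i)+r(p,q_i)-r(p,p_i)}{L_i}+r(p,p_i),$$ where on the right-hand side $x\in[0,L_i]$ denotes the parameter of the point $x\in e_i$.
   Context: A metrized graph $\Gamma$ is a finite connected graph whose edges are equipped with a distinguished parametrization by line segments (multiple edges and self-loops are allowed). The valence of $p\in\Gamma$ is the number of directions emanating from $p$. A vertex set $V(\Gamma)$ is a finite non-empty subset of $\Gamma$ containing every point of valence $\neq 2$ (additional points of valence 2 may be included). The set $E(\Gamma)$ of edges is the set of closed line segments with end points in $V(\Gamma)$ into which $V(\Gamma)$ divides $\Gamma$; the length of $e_i$ is a positive real number $L_i$. Parametrization convention: an edge $e_i$ of length $L_i$ with end points $p_i,q_i$ is identified with $[0,L_i]$ so that $p_i$ corresponds to $0$ and $q_i$ to $L_i$. A point of $e_i$ and the corresponding real number in $[0,L_i]$ are denoted by the same letter: in the arguments of $r$ the letters denote points of $\Gamma$, elsewhere in formulas they denote the real parameters. Voltage and resistance functions: view $\Gamma$ as a resistive electric circuit in which each edge has resistance equal to its length. For $x,y,z\in\Gamma$, $j_z(x,y)$ is the voltage difference between $x$ and $z$ when unit current enters at $y$ and exits at $z$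 (with reference voltage $0$ at $z$). Equivalently, for fixed $y,z$, $x\mapsto j_z(x,y)$ is the unique continuous piecewise affine function $f$ on $\Gamma$ with $f(z)=0$ and $\Delta f=\delta_y-\delta_z$, where $\Delta f=-\sum_{p}\sigma_p(f)\,\delta_p$ and $\sigma_p(f)$ is the sum of the slopes of $f$ in all directions emanating from $p$. The resistance function is $r(x,y)=j_y(x,x)$, the effective resistance between $x$ and $y$. *)

(* Defs.v *)
From HB Require Import structures.
From mathcomp Require Import all_boot all_order all_algebra.
From mathcomp Require Import all_classical all_reals all_analysis.
Import Order.TTheory GRing.Theory Num.Theory.
Import numFieldNormedType.Exports.

Set Implicit Arguments.
Unset Strict Implicit.
Unset Printing Implicit Defensive.

Local Open Scope classical_set_scope.
Local Open Scope ring_scope.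

(* A metrized graph together with a chosen vertex set.  An edge e is the       *)
(* segment [0, len e], with 0 glued to src e and len e glued to tgt e.         *)
(* Self-loops and multiple edges are allowed.  As every point outside the      *)
(* vertex set is interior to an edge, it automatically has valence 2.          *)
Record metrized_graph (R : realType) := MetrizedGraph {
  vertex : finType;
  edge : finType;
  src : edge -> vertex;
  tgt : edge -> vertex;
  len : edge -> R;
  len_gt0 : forall e, 0 < len e;
  vertex_nonempty : (0 < #|vertex|)%N;
  graph_connected : forall u v : vertex,
    connect [rel a b | [exists e, ((src e == a) && (tgt e == b))
                               || ((src e == b) && (tgt e == a))]] u v
}.

Section MetrizedGraph.
Context {R : realType} (G : metrized_graph R).

(* The underlying set of the quotient: each point is either a vertex or an     *)
(* interior point of exactly one edge, so the gluing needs no quotient type.   *)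
Definition point : choiceType :=
  (vertex G + {u : edge G * R | 0 < u.2 < len u.1})%type.

Definition vertex_point (v : vertex G) : point := inl v.

(* The parametrization [0, len e] -> G of the edge e.  An argument outside     *)
(* ]0, len e[ is sent to the nearest end point.                                *)
Definition edge_point (e : edge G) (t : R) : point :=
  match insub (e, t) : option {u : edge G * R | 0 < u.2 < len u.1} with
  | Some u => inr u
  | None => if t <= 0 then inl (src e) else inl (tgt e)
  end.

Implicit Types (f : point -> R) (e : edge G) (t : R).

(* G carries the quotient topology of its edges, so f is continuous iff it is  *)
(* continuous along every edge.  The sequence s lists the break points.        *)
Definition continuous_piecewise_affine f : Prop :=
  forall e,
    {within `[0, len e], continuous (fun t : R => f (edge_point e t))} /\
    exists s : seq R, forall a b : R, 0 <= a -> b <= len e ->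
      (forall c, c \in s -> ~~ (a < c < b)) ->
      exists m k : R, forall t, a < t < b -> f (edge_point e t) = m * t + k.

(* The slopes of f at the point of parameter t of e, in the two directions     *)
(* along e: towards tgt e (t < len e) and towards src e (0 < t).               *)
Definition slope_fwd f e t : R :=
  lim ((f (edge_point e (t + h)) - f (edge_point e t)) / h @[h --> 0^'+]).
Definition slope_bwd f e t : R :=
  lim ((f (edge_point e (t - h)) - f (edge_point e t)) / h @[h --> 0^'+]).

(* A self-loop at v contributes two of the directions emanating from v.        *)
Definition slope_sum f (p : point) : R :=
  match p with
  | inl v => \sum_(e : edge G | src e == v) slope_fwd f e 0
             + \sum_(e : edge G | tgt e == v) slope_bwd f e (len e)
  | inr u => slope_fwd f (val u).1 (val u).2 + slope_bwd f (val u).1 (val u).2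
  end.

(* Finitely supported discrete measures are represented by their mass          *)
(* functions: laplacian f p is the coefficient of delta_p.                     *)
Definition laplacian f (p : point) : R := - slope_sum f p.
Definition point_mass (q p : point) : R := (p == q)%:R.

Definition is_voltage (z y : point) f : Prop :=
  [/\ continuous_piecewise_affine f,
      f z = 0 &
      forall p, laplacian f p = point_mass y p - point_mass z p].

(* voltage z x y is j_z(x, y), the value at x of the function characterized    *)
(* by is_voltage z y.  The zero function is only a default value for xget.     *)
Definition voltage (z x y : point) : R :=
  xget (fun _ : point => 0 : R) [set f | is_voltage z y f] x.

Definition resistance (x y : point) : R := voltage y x x.

End MetrizedGraph.

(* Main.v *)
(* Let a, b be the end points of the edge, L its length, s = x / L.  If U and W
   are the potentials of a unit current entering at p and leaving at a,
   respectively b, then (1 - s) U + s W minus a tent function on the edge with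
   apex at x is a potential for the current from p to x.  Potentials being
   unique up to a constant, r(p, x) is its potential drop between p and x; the
   cross terms U(b) + W(a) are removed by reading off r(a, b) from W - U.
   Existence of U and W is linear algebra on the vertices.  Uniqueness holds
   because a function without kinks is affine on each edge, and its Dirichlet
   energy then vanishes by the discrete Green identity. *)
Require Import Defs.
From HB Require Import structures.
From mathcomp Require Import all_boot all_order all_algebra.
From mathcomp Require Import all_classical all_reals all_analysis.
From mathcomp Require Import ring lra.
Import Order.TTheory GRing.Theory Num.Theory.
Import numFieldNormedType.Exports.

Set Implicit Arguments.
Unset Strict Implicit.
Unset Printing Implicit Defensive.

Local Open Scope ring_scope.

(** * One-sided slopes of continuous piecewise affine functions *)

Section PiecewiseAffine.
Context {R : realType} (G : metrized_graph R).
Implicit Types (f g : Defs.point G -> R) (e : edge G) (s t a b c m k : R).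

Lemma edge_point_src e : edge_point e 0 = inl (src e).
Proof. by rewrite /edge_point insubF /= ?ltxx // lexx. Qed.

Lemma edge_point_tgt e : edge_point e (len e) = inl (tgt e).
Proof.
by rewrite /edge_point insubF /= ?ltxx ?andbF // leNgt len_gt0.
Qed.

Lemma edge_point_interior e t (te : 0 < t < len e) :
  edge_point e t =
  inr (exist (fun u : edge G * R => 0 < u.2 < len u.1) (e, t) te).
Proof.
rewrite /edge_point; case: insubP => [u _ uE|]; last by rewrite te.
by congr inr; apply: val_inj.
Qed.

Lemma edge_point_val (u : {u : edge G * R | 0 < u.2 < len u.1}) :
  edge_point (val u).1 (val u).2 = inr u.
Proof. by case: u => -[e t] te /=; rewrite edge_point_interior. Qed.

(** Continuity extends the affine formula from the open interval to its end [t], so the difference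
    quotients at [t] are eventually constant and the limit needs no computation. *)
Lemma slope_fwd_affine f e t b m k :
  continuous_piecewise_affine f -> 0 <= t -> t < b -> b <= len e ->
  (forall s, t < s < b -> f (edge_point e s) = m * s + k) ->
  f (edge_point e t) = m * t + k /\ slope_fwd f e t = m.
Proof.
move=> /(_ e)[+ _] t0 tb be fE.
move=> /(continuous_within_itvP _ (len_gt0 e))[cf cf0 _].
(* At the parameter 0 only the one-sided continuity of [f] along the edge is available; elsewhere
   two-sided continuity is restricted to the right. *)
have cft : (f (edge_point e x) @[x --> t^'+] --> f (edge_point e t))%classic.
  move: t0; rewrite le_eqVlt => /predU1P[<-//|t0].
  by apply/cvg_at_right_filter/cf; rewrite in_itv/= t0 (lt_le_trans tb).
have fEt : f (edge_point e t) = m * t + k.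
  have fE' : (f (edge_point e x) @[x --> t^'+] --> m * t + k)%classic.
    have lin : ((m * x + k) @[x --> t^'+] --> m * t + k)%classic.
      apply: cvg_at_right_filter; apply: cvgD; last exact: cvg_cst.
      by apply: cvgM; [exact: cvg_cst | exact: cvg_id].
    apply: cvg_trans lin; apply: near_eq_cvg; near=> x.
    by rewrite fE//; apply/andP; split; near: x;
      [exact: nbhs_right_gt|exact: nbhs_right_lt].
  exact: norm_cvg_unique cft fE'.
split=> //; apply: norm_lim_near_cst; near=> h.
have h0 : 0 < h by near: h; exact: nbhs_right_gt.
have hb : h < b - t by near: h; apply: nbhs_right_lt; rewrite subr_gt0.
rewrite fE ?fEt; first by field; rewrite gt_eqF.
by apply/andP; split; lra.
Unshelve. all: by end_near. Qed.

Lemma slope_bwd_affine f e t a m k :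
  continuous_piecewise_affine f -> 0 <= a -> a < t -> t <= len e ->
  (forall s, a < s < t -> f (edge_point e s) = m * s + k) ->
  f (edge_point e t) = m * t + k /\ slope_bwd f e t = - m.
Proof.
move=> /(_ e)[+ _] a0 at_ te fE.
move=> /(continuous_within_itvP _ (len_gt0 e))[cf _ cfe].
have cft : (f (edge_point e x) @[x --> t^'-] --> f (edge_point e t))%classic.
  move: te; rewrite le_eqVlt => /predU1P[->//|te].
  by apply/cvg_at_left_filter/cf; rewrite in_itv/= te (le_lt_trans a0).
have fEt : f (edge_point e t) = m * t + k.
  have fE' : (f (edge_point e x) @[x --> t^'-] --> m * t + k)%classic.
    have lin : ((m * x + k) @[x --> t^'-] --> m * t + k)%classic.
      apply: cvg_at_left_filter; apply: cvgD; last exact: cvg_cst.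
      by apply: cvgM; [exact: cvg_cst | exact: cvg_id].
    apply: cvg_trans lin; apply: near_eq_cvg; near=> x.
    by rewrite fE//; apply/andP; split; near: x;
      [exact: nbhs_left_gt|exact: nbhs_left_lt].
  exact: norm_cvg_unique cft fE'.
split=> //; apply: norm_lim_near_cst; near=> h.
have h0 : 0 < h by near: h; exact: nbhs_right_gt.
have hb : h < t - a by near: h; apply: nbhs_right_lt; rewrite subr_gt0.
rewrite fE ?fEt; first by field; rewrite gt_eqF.
by apply/andP; split; lra.
Unshelve. all: by end_near. Qed.

(** A forward slope only sees a short interval after [t]. Shrinking it past finitely many break
    points makes two functions affine on it at once, which gives linearity of slopes. *)
Lemma free_right (l : seq R) t b : t < b ->
  exists c, [/\ t < c, c <= b & forall d, d \in l -> ~~ (t < d < c)].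
Proof.
move=> tb; elim: l => [|d l [c [tc cb lc]]]; first by exists b.
have [dt|td] := leP d t.
  exists c; split=> // d'; rewrite inE => /predU1P[->|/lc//].
  by rewrite ltNge dt.
exists (Num.min c d); split; rewrite ?lt_min ?tc ?ge_min ?cb// => d'.
rewrite inE => /predU1P[->|/lc]; first by rewrite lt_min ltxx !andbF.
by rewrite lt_min; apply: contra => /and3P[-> ->].
Qed.

Lemma free_left (l : seq R) a t : a < t ->
  exists c, [/\ a <= c, c < t & forall d, d \in l -> ~~ (c < d < t)].
Proof.
move=> at_; elim: l => [|d l [c [tc cb lc]]]; first by exists a.
have [dt|td] := leP t d.
  exists c; split=> // d'; rewrite inE => /predU1P[->|/lc//].
  by rewrite [d < t]ltNge dt andbF.
exists (Num.max c d); split; rewrite ?gt_max ?td ?le_max ?tc ?cb// => d'.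
rewrite inE => /predU1P[->|/lc]; first by rewrite gt_max ltxx !andbF.
by rewrite gt_max; apply: contra => /andP[/andP[-> _] ->].
Qed.

Lemma cpa_linear f g c : continuous_piecewise_affine f ->
  continuous_piecewise_affine g ->
  continuous_piecewise_affine (fun p => f p + c * g p).
Proof.
move=> cf cg e; have [cfe [l fl]] := cf e; have [cge [l' gl']] := cg e.
split.
  apply: (within_continuousD cfe (g := fun t => c * g (edge_point e t))).
  apply: (within_continuous_comp _ (fun t => g (edge_point e t))
    (fun y => c * y)) => // y _.
  exact: mulrl_continuous.
exists (l ++ l') => a b a0 be lab.
have [|m [k fE]] := fl a b a0 be.
  by move=> d dl; apply: lab; rewrite mem_cat dl.
have [|m' [k' gE]] := gl' a b a0 be.
  by move=> d dl; apply: lab; rewrite mem_cat dl orbT.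
exists (m + c * m'), (k + c * k') => t tab.
by rewrite fE// gE//; ring.
Qed.

Lemma slope_fwd_linear f g c e t : continuous_piecewise_affine f ->
  continuous_piecewise_affine g -> 0 <= t < len e ->
  slope_fwd (fun p => f p + c * g p) e t = slope_fwd f e t + c * slope_fwd g e t.
Proof.
move=> cf cg /andP[t0 te]; have [_ [l fl]] := cf e; have [_ [l' gl']] := cg e.
have [b [tb be lb]] := free_right (l ++ l') te.
have [|m [k fE]] := fl t b t0 be.
  by move=> d dl; apply: lb; rewrite mem_cat dl.
have [|m' [k' gE]] := gl' t b t0 be.
  by move=> d dl; apply: lb; rewrite mem_cat dl orbT.
have [_ ->] := slope_fwd_affine cf t0 tb be fE.
have [_ ->] := slope_fwd_affine cg t0 tb be gE.
have [//|_ ->//] := slope_fwd_affine (m := m + c * m') (k := k + c * k')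
  (cpa_linear c cf cg) t0 tb be.
by move=> s sb; rewrite fE// gE//; ring.
Qed.

Lemma slope_bwd_linear f g c e t : continuous_piecewise_affine f ->
  continuous_piecewise_affine g -> 0 < t <= len e ->
  slope_bwd (fun p => f p + c * g p) e t = slope_bwd f e t + c * slope_bwd g e t.
Proof.
move=> cf cg /andP[t0 te]; have [_ [l fl]] := cf e; have [_ [l' gl']] := cg e.
have [a [a0 at_ la]] := free_left (l ++ l') t0.
have [|m [k fE]] := fl a t a0 te.
  by move=> d dl; apply: la; rewrite mem_cat dl.
have [|m' [k' gE]] := gl' a t a0 te.
  by move=> d dl; apply: la; rewrite mem_cat dl orbT.
have [_ ->] := slope_bwd_affine cf a0 at_ te fE.
have [_ ->] := slope_bwd_affine cg a0 at_ te gE.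
have [|_ ->] := slope_bwd_affine (m := m + c * m') (k := k + c * k')
  (cpa_linear c cf cg) a0 at_ te.
  by move=> s sb; rewrite fE// gE//; ring.
by rewrite mulrN opprD.
Qed.

Lemma laplacian_linear f g c p : continuous_piecewise_affine f ->
  continuous_piecewise_affine g ->
  laplacian (fun p => f p + c * g p) p = laplacian f p + c * laplacian g p.
Proof.
move=> cf cg; rewrite /laplacian; case: p => [v|[[e t] /= te]] /=.
  under eq_bigr do rewrite slope_fwd_linear ?lexx ?len_gt0//.
  under [X in _ + X]eq_bigr do rewrite slope_bwd_linear ?lexx ?len_gt0//.
  by rewrite !big_split/= -!mulr_sumr; ring.
case/andP: te => t0 te.
by rewrite slope_fwd_linear ?slope_bwd_linear ?t0 ?te ?ltW//; ring.
Qed.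

(** Induction on the list of break points: a point without a kink can be struck off the list, and
    with an empty list the whole edge is a single affine piece. *)
Lemma no_kink_affine f e : continuous_piecewise_affine f ->
  (forall t, 0 < t < len e -> slope_fwd f e t + slope_bwd f e t = 0) ->
  exists m, forall t, 0 <= t <= len e ->
    f (edge_point e t) = f (inl (src e)) + m * t.
Proof.
move=> cf nk; have [_ [l]] := cf e.
elim: l => [|c l IH] fl.
  have [//|m [k fE]] := fl 0 (len e) (lexx _) (lexx _).
  have [f0 _] := slope_fwd_affine cf (lexx _) (len_gt0 e) (lexx _) fE.
  have [fL _] := slope_bwd_affine cf (lexx _) (len_gt0 e) (lexx _) fE.
  exists m => t /andP[t0 te]; rewrite -edge_point_src f0.
  move: t0 te; rewrite le_eqVlt => /predU1P[<- _|t0]; first by rewrite f0; ring.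
  rewrite le_eqVlt => /predU1P[->|te]; first by rewrite fL; ring.
  by rewrite fE ?t0//; ring.
apply: IH => a b a0 be lab.
(* Only an interval containing [c] needs a new argument. The pieces on either side of [c] have the
   same slope since there is no kink, hence the same constant by continuity at [c]. *)
have [/andP[ac cb]|cab] := boolP (a < c < b); last first.
  by apply: fl => // d; rewrite inE => /predU1P[->|/lab].
have [|m [k fE]] := fl a c a0 (ltW (lt_le_trans cb be)).
  move=> d; rewrite inE => /predU1P[->|/lab]; first by rewrite ltxx andbF.
  by apply: contra => /andP[-> /lt_trans->].
have [|m' [k' fE']] := fl c b (le_trans a0 (ltW ac)) be.
  move=> d; rewrite inE => /predU1P[->|/lab]; first by rewrite ltxx.
  by apply: contra => /andP[/(lt_trans ac)-> ->].
have [fc sb] := slope_bwd_affine cf a0 ac (ltW (lt_le_trans cb be)) fE.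
have [fc' sf] := slope_fwd_affine cf (le_trans a0 (ltW ac)) cb be fE'.
have ce : 0 < c < len e by rewrite (le_lt_trans a0 ac) (lt_le_trans cb be).
have /eqP := nk _ ce; rewrite sf sb subr_eq0 => /eqP mm'.
have kk' : k' = k by move: fc'; rewrite fc mm' => /addrI.
exists m, k => t /andP[at_ tb]; have [tc|ct|->//] := ltgtP t c.
  by rewrite fE ?at_.
by rewrite fE' ?ct// mm' kk'.
Qed.

End PiecewiseAffine.

(** * The discrete Laplacian and the Poisson equation on the vertices *)

Lemma linear_injective_surjective (K : fieldType) (V : vectType K)
    (f : {linear V -> V}) : injective f -> forall w, exists v, f v = w.
Proof.
move=> f_inj w; have f0 : lker (linfun f) == 0%VS.
  by apply/lker0P => u v; rewrite !lfunE; exact: f_inj.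
exists ((linfun f)^-1%VF w).
by have := lker0_lfunVK f0 w; rewrite lfunE.
Qed.

Section DiscreteLaplacian.
Context {R : realType} (G : metrized_graph R).
Implicit Types (u w : vertex G -> R) (e : edge G) (a b p v : vertex G).

(** This is the weighted graph Laplacian with conductances [1 / len e], with the sign of
    [laplacian]. A self-loop contributes 0 to both sums. *)
Definition discrete_laplacian u v : R :=
  \sum_(e : edge G | src e == v) (u (src e) - u (tgt e)) / len e
  + \sum_(e : edge G | tgt e == v) (u (tgt e) - u (src e)) / len e.

Lemma discrete_laplacian_linear u w c v :
  discrete_laplacian (fun a => u a + c * w a) v =
  discrete_laplacian u v + c * discrete_laplacian w v.
Proof.
rewrite /discrete_laplacian mulrDr addrACA !mulr_sumr -!big_split/=.
by congr (_ + _); apply: eq_bigr => e _; field; rewrite gt_eqF ?len_gt0.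
Qed.

(** Summation by parts: once the double sums are regrouped by edges, each edge occurs once through
    its source and once through its target. For [w = u] the right-hand side is the Dirichlet
    energy. *)
Lemma discrete_green u w :
  \sum_v w v * discrete_laplacian u v =
  \sum_(e : edge G) (w (src e) - w (tgt e)) * (u (src e) - u (tgt e)) / len e.
Proof.
under eq_bigr do rewrite mulrDr !mulr_sumr.
rewrite big_split/=.
transitivity (\sum_(e : edge G) w (src e) * ((u (src e) - u (tgt e)) / len e) +
  \sum_(e : edge G) w (tgt e) * ((u (tgt e) - u (src e)) / len e)).
  congr (_ + _).
    rewrite [RHS](partition_big (@src _ G) predT)//=.
    by apply: eq_bigr => v _; apply: eq_bigr => e /eqP->.
  rewrite [RHS](partition_big (@tgt _ G) predT)//=.
  by apply: eq_bigr => v _; apply: eq_bigr => e /eqP->.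
by rewrite -big_split/=; apply: eq_bigr => e _; ring.
Qed.

Lemma sum_discrete_laplacian u : \sum_v discrete_laplacian u v = 0.
Proof.
have := discrete_green u (fun=> 1).
under eq_bigr do rewrite mul1r.
by move=> ->; rewrite big1// => e _; rewrite subrr !mul0r.
Qed.

(** The energy of [u] is 0 and all its terms are nonnegative, so [u] agrees at the two ends of every
    edge; connectedness does the rest. *)
Lemma discrete_harmonic_constant u : (forall v, discrete_laplacian u v = 0) ->
  forall a b, u a = u b.
Proof.
move=> Du0; have := discrete_green u u.
rewrite big1; last by move=> v _; rewrite Du0 mulr0.
move/esym/psumr_eq0P => energy0.
have edge_eq e : u (src e) = u (tgt e).
  have /eqP := energy0 (fun i _ => divr_ge0 (sqr_ge0 _) (ltW (len_gt0 i))) e isT.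
  rewrite !mulf_eq0 orbb invr_eq0 (gt_eqF (len_gt0 e)) orbF subr_eq0.
  by move/eqP.
move=> a b; have /connectP[l] := graph_connected a b.
elim: l a => [a _ -> //|c l IH a /= /andP[/existsP[e eac] lc lb]].
rewrite -(IH c lc lb).
by case/orP: eac => /andP[/eqP<- /eqP<-]; rewrite edge_eq.
Qed.

(* Adding the potential at p to the discrete Laplacian makes it injective,    *)
(* and summing the resulting equation over all vertices shows that the added  *)
(* term vanishes when the right-hand side has total mass 0.                   *)
Definition grounded_laplacian p (u : {ffun vertex G -> R^o}) :
    {ffun vertex G -> R^o} :=
  [ffun v => discrete_laplacian u v + (v == p)%:R * u p].

Lemma grounded_laplacian_is_linear p : linear (grounded_laplacian p).
Proof.
move=> c u w; apply/ffunP => v; rewrite !ffunE.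
have -> : discrete_laplacian (c *: u + w) v =
          discrete_laplacian (fun a => w a + c * u a) v.
  by congr discrete_laplacian; apply/funext => a; rewrite !ffunE addrC.
rewrite discrete_laplacian_linear /GRing.scale/=; ring.
Qed.

HB.instance Definition _ p := GRing.isLinear.Build R {ffun vertex G -> R^o}
  {ffun vertex G -> R^o} _ (grounded_laplacian p)
  (grounded_laplacian_is_linear p).

Lemma sum_grounded_laplacian p u :
  \sum_v (discrete_laplacian u v + (v == p)%:R * u p) = u p.
Proof.
rewrite big_split/= sum_discrete_laplacian add0r (bigD1 p)//= eqxx mul1r.
by rewrite big1 ?addr0// => v /negPf->; rewrite mul0r.
Qed.

(** For [u] in the kernel, summing over the vertices gives [u p = 0]. Then [u] is harmonic, hence
    constant, hence 0. *)
Lemma grounded_laplacian_inj p : injective (grounded_laplacian p).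
Proof.
apply: raddf_inj => u /ffunP gu0.
have up0 : u p = 0.
  rewrite -(sum_grounded_laplacian p u); apply: big1 => v _.
  by have := gu0 v; rewrite !ffunE.
have uc := discrete_harmonic_constant (u := u).
apply/ffunP => v; rewrite (uc _ v p) ?up0 ?ffunE// => {}v.
by have := gu0 v; rewrite !ffunE up0 mulr0 addr0.
Qed.

Lemma discrete_poisson w : \sum_v w v = 0 ->
  exists u, forall v, discrete_laplacian u v = w v.
Proof.
move=> w0; have /card_gt0P[p _] := vertex_nonempty G.
have [u /ffunP uw] :=
  linear_injective_surjective (@grounded_laplacian_inj p) [ffun v => w v].
have uwv v : discrete_laplacian u v + (v == p)%:R * u p = w v.
  by have := uw v; rewrite !ffunE.
have up0 : u p = 0.
  by rewrite -(sum_grounded_laplacian p u) (eq_bigr _ (fun v _ => uwv v)).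
by exists u => v; rewrite -uwv up0 mulr0 addr0.
Qed.

End DiscreteLaplacian.

(** * From vertex potentials to potentials on the graph, and uniqueness *)

Section EdgeAffine.
Context {R : realType} (G : metrized_graph R).
Implicit Types (f g : Defs.point G -> R) (e : edge G) (u : vertex G -> R).

(** The coefficients are expressed through the values at the vertices, so such an [f] is determined
    by its restriction to them; on a self-loop it is constant. *)
Definition edge_affine f := forall e t, 0 <= t <= len e ->
  f (edge_point e t) =
  (f (inl (tgt e)) - f (inl (src e))) / len e * t + f (inl (src e)).

Lemma edge_affine_cpa f : edge_affine f -> continuous_piecewise_affine f.
Proof.
move=> af e; split; last first.
  exists [::] => a b a0 be _; eexists; eexists => t /andP[at_ tb].
  by apply: af; rewrite (le_trans a0 (ltW at_)) (le_trans (ltW tb)).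
apply: (@subspace_eq_continuous _ _ R
  (fun t : R => (f (inl (tgt e)) - f (inl (src e))) / len e * t + f (inl (src e)))).
  by move=> t; rewrite inE/= in_itv/= => /af/esym.
apply: continuous_subspaceT => t.
apply: cvgD; last exact: cvg_cst.
by apply: cvgM; [exact: cvg_cst|exact: cvg_id].
Qed.

Lemma edge_affine_slope_fwd f e t : edge_affine f -> 0 <= t < len e ->
  slope_fwd f e t = (f (inl (tgt e)) - f (inl (src e))) / len e.
Proof.
move=> af /andP[t0 te].
have [|_ ->//] := slope_fwd_affine (edge_affine_cpa af) t0 te (lexx _)
  (m := (f (inl (tgt e)) - f (inl (src e))) / len e) (k := f (inl (src e))).
by move=> s /andP[ts se]; rewrite af// (le_trans t0 (ltW ts)) ltW.
Qed.

Lemma edge_affine_slope_bwd f e t : edge_affine f -> 0 < t <= len e ->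
  slope_bwd f e t = (f (inl (src e)) - f (inl (tgt e))) / len e.
Proof.
move=> af /andP[t0 te].
have [|_ ->//] := slope_bwd_affine (edge_affine_cpa af) (lexx _) t0 te
  (m := (f (inl (tgt e)) - f (inl (src e))) / len e) (k := f (inl (src e))).
  by move=> s /andP[ts se]; rewrite af// ltW// (ltW (lt_le_trans se te)).
by rewrite -mulNr opprB.
Qed.

Lemma edge_affine_laplacian_vertex f v : edge_affine f ->
  laplacian f (inl v) = discrete_laplacian (fun a => f (inl a)) v.
Proof.
move=> af; rewrite /laplacian/= opprD /discrete_laplacian -!sumrN.
congr (_ + _); apply: eq_bigr => e _.
  by rewrite edge_affine_slope_fwd ?lexx ?len_gt0// -mulNr opprB.
by rewrite edge_affine_slope_bwd ?lexx ?len_gt0// -mulNr opprB.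
Qed.

Lemma edge_affine_laplacian_interior f
    (w : {u : edge G * R | 0 < u.2 < len u.1}) : edge_affine f ->
  laplacian f (inr w) = 0.
Proof.
move=> af; case: w => -[e t] /= te; rewrite /laplacian/=.
have /andP[t0 tl] := te.
rewrite edge_affine_slope_fwd ?edge_affine_slope_bwd ?t0 ?tl ?ltW//; ring.
Qed.

(** Vanishing of the Laplacian inside the edges makes [f] affine on each edge; vanishing at the
    vertices then makes its restriction discretely harmonic. *)
Lemma harmonic_constant f : continuous_piecewise_affine f ->
  (forall p, laplacian f p = 0) -> forall p q, f p = f q.
Proof.
move=> cf Lf.
have nk e t : 0 < t < len e -> slope_fwd f e t + slope_bwd f e t = 0.
  by move=> te; apply: oppr_inj; rewrite oppr0; exact: (Lf (inr (exist _ (e, t) te))).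
have af : edge_affine f.
  move=> e t te; have [m fE] := no_kink_affine cf (nk e).
  rewrite fE// -edge_point_tgt fE ?lexx ?ltW ?len_gt0//.
  by field; rewrite gt_eqF ?len_gt0.
have cv := discrete_harmonic_constant (u := fun a => f (inl a))
  (fun v => etrans (esym (edge_affine_laplacian_vertex v af)) (Lf _)).
have fE : forall p, exists v, f p = f (inl v).
  case=> [v|w]; first by exists v.
  exists (src (val w).1); rewrite -edge_point_val af ?(cv _ (src (val w).1)).
    by rewrite subrr !mul0r add0r.
  by have /andP[/ltW-> /ltW->] := valP w.
by move=> p q; have [v ->] := fE p; have [v' ->] := fE q.
Qed.

Definition affine_extension u (p : Defs.point G) : R :=
  match p with
  | inl v => u v
  | inr w => (u (tgt (val w).1) - u (src (val w).1)) / len (val w).1 * (val w).2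
             + u (src (val w).1)
  end.

Lemma affine_extensionP u : edge_affine (affine_extension u).
Proof.
move=> e t /andP[]; rewrite le_eqVlt => /predU1P[<- _|t0].
  by rewrite edge_point_src mulr0 add0r.
rewrite le_eqVlt => /predU1P[->|te].
  by rewrite edge_point_tgt divfK ?subrK// gt_eqF ?len_gt0.
have tE : 0 < t < len e by rewrite t0.
by rewrite (edge_point_interior tE).
Qed.

(** The normalization at [z] is irrelevant to a potential drop: two potentials with the same
    Laplacian differ by a harmonic function, which is constant. *)
Lemma resistanceE f y z : continuous_piecewise_affine f ->
  (forall p, laplacian f p = point_mass y p - point_mass z p) ->
  resistance y z = f y - f z.
Proof.
move=> cf Lf.
have a1 : edge_affine (fun=> 1) by move=> e t _; rewrite subrr !mul0r add0r.
have c1 := edge_affine_cpa a1.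
have L1 (p : Defs.point G) : laplacian (fun=> 1) p = 0.
  case: p => [v|w]; last exact: (edge_affine_laplacian_interior w a1).
  rewrite edge_affine_laplacian_vertex// /discrete_laplacian subrr.
  by rewrite !big1 ?addr0// => e _; rewrite mul0r.
(* Subtracting [f z], written as a multiple of the harmonic function 1 so that linearity applies,
   grounds [f] at [z]. This witness ensures that [xget] does not return its default. *)
have fP : is_voltage z y (fun p => f p + (- f z) * 1).
  split; [exact: cpa_linear|by rewrite mulr1 subrr|].
  by move=> p; rewrite laplacian_linear// L1 mulr0 addr0.
rewrite /resistance /voltage; set h := xget _ _.
have [ch hz Lh] : is_voltage z y h by apply: xgetPex; exists (fun p => f p + (- f z) * 1).
have /(harmonic_constant (cpa_linear (-1) ch cf))/(_ y z) :
    forall p, laplacian (fun p => h p + -1 * f p) p = 0.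
  by move=> p; rewrite laplacian_linear// Lh Lf; ring.
by rewrite hz; lra.
Qed.

End EdgeAffine.

(** * The tent function on an edge and its Laplacian *)

Section Tent.
Context {R : realType} (G : metrized_graph R) (e0 : edge G) (x : R)
  (hx : 0 < x < len e0).
Implicit Types (e : edge G) (t : R).
Let L := len e0.

(* The tent is supported on e0, with slopes 1 - x / L and - x / L on the two   *)
(* sides of its apex at parameter x, so that its Laplacian is a unit mass at   *)
(* the apex balanced by masses at the two end points.                          *)
Definition tent (p : Defs.point G) : R :=
  match p with
  | inl _ => 0
  | inr w => if (val w).1 == e0
             then Num.min ((val w).2 * (L - x)) ((L - (val w).2) * x) / L
             else 0
  end.

Let L_gt0 : 0 < L. Proof. exact: len_gt0. Qed.
Let x_gt0 : 0 < x. Proof. by case/andP: hx. Qed.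
Let x_ltL : x < L. Proof. by case/andP: hx. Qed.

(** The minimum is 0 at both ends of the edge, which matches the value 0 of [tent] at the
    vertices. *)
Lemma tentE t : 0 <= t <= L ->
  tent (edge_point e0 t) = Num.min (t * (L - x)) ((L - t) * x) / L.
Proof.
move=> /andP[]; rewrite le_eqVlt => /predU1P[<- _|t0].
  rewrite edge_point_src/= mul0r min_l ?mul0r//.
  by rewrite subr0 mulr_ge0// ltW.
rewrite le_eqVlt => /predU1P[->|tL].
  rewrite edge_point_tgt/= subrr mul0r min_r ?mul0r//.
  by rewrite mulr_ge0 ?ltW ?subr_gt0.
have te : 0 < t < len e0 by rewrite t0.
by rewrite (edge_point_interior te)/= eqxx.
Qed.

Lemma tent_off e t : e != e0 -> 0 <= t <= len e -> tent (edge_point e t) = 0.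
Proof.
move=> /negPf ee0 /andP[]; rewrite le_eqVlt => /predU1P[<- _|t0].
  by rewrite edge_point_src.
rewrite le_eqVlt => /predU1P[->|tL]; first by rewrite edge_point_tgt.
have te : 0 < t < len e by rewrite t0.
by rewrite (edge_point_interior te)/= ee0.
Qed.

Lemma tent_left t : 0 <= t <= x -> tent (edge_point e0 t) = (1 - x / L) * t + 0.
Proof.
move=> /andP[t0 tx]; rewrite tentE ?t0 ?(le_trans tx) ?ltW// min_l.
  by field; rewrite gt_eqF.
by have := ler_wpM2r (ltW L_gt0) tx; lra.
Qed.

Lemma tent_right t : x <= t <= L -> tent (edge_point e0 t) = - (x / L) * t + x.
Proof.
move=> /andP[xt tL]; rewrite tentE ?tL ?(le_trans _ xt) ?ltW// min_r.
  by field; rewrite gt_eqF.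
by have := ler_wpM2r (ltW L_gt0) xt; lra.
Qed.

Lemma tent_cpa : continuous_piecewise_affine tent.
Proof.
move=> e; have [->|ee0] := eqVneq e e0; last first.
  split; last first.
    exists [::] => a b a0 be _; exists 0, 0 => t /andP[at_ tb].
    rewrite tent_off// ?mul0r ?addr0//.
    by rewrite (le_trans a0 (ltW at_)) (le_trans (ltW tb)).
  apply: (@subspace_eq_continuous _ _ R (fun=> 0)).
    by move=> t; rewrite inE/= in_itv/= => /(tent_off ee0)/esym.
  by apply: continuous_subspaceT => t; exact: cvg_cst.
split; last first.
  (* The apex is the only break point, so an interval avoiding it lies on one side of it. *)
  exists [:: x] => a b a0 be /(_ x (mem_head _ _)).
  rewrite negb_and -!leNgt => /orP[xa|bx].
    exists (- (x / L)), x => t /andP[at_ tb]; apply: tent_right.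
    by rewrite (le_trans xa (ltW at_)) (le_trans (ltW tb) be).
  exists (1 - x / L), 0 => t /andP[at_ tb]; apply: tent_left.
  by rewrite (le_trans a0 (ltW at_)) (le_trans (ltW tb) bx).
(* Writing the tent as a minimum gives continuity at the apex without gluing the two sides. *)
apply: (@subspace_eq_continuous _ _ R
  (fun t : R => Num.min (t * (L - x)) ((L - t) * x) / L)).
  by move=> t; rewrite inE/= in_itv/= => /tentE/esym.
apply: continuous_subspaceT => t; apply: cvgM; last exact: cvg_cst.
apply: (@continuous_min _ _ (fun t : R => t * (L - x)) (fun t => (L - t) * x)).
  by apply: cvgM; [exact: cvg_id|exact: cvg_cst].
apply: cvgM; last exact: cvg_cst.
by apply: cvgB; [exact: cvg_cst|exact: cvg_id].
Qed.

Lemma tent_slope_fwd_left t : 0 <= t < x -> slope_fwd tent e0 t = 1 - x / L.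
Proof.
move=> /andP[t0 tx].
have [|_ ->//] := slope_fwd_affine (m := 1 - x / L) (k := 0)
  tent_cpa t0 tx (ltW x_ltL).
move=> s /andP[ts sx]; apply: tent_left.
by rewrite (le_trans t0 (ltW ts)) ltW.
Qed.

Lemma tent_slope_fwd_right t : x <= t < L -> slope_fwd tent e0 t = - (x / L).
Proof.
move=> /andP[xt tL].
have [|_ ->//] := slope_fwd_affine (m := - (x / L)) (k := x)
  tent_cpa (le_trans (ltW x_gt0) xt) tL (lexx _).
move=> s /andP[ts sL]; apply: tent_right.
by rewrite (le_trans xt (ltW ts)) ltW.
Qed.

Lemma tent_slope_bwd_left t : 0 < t <= x -> slope_bwd tent e0 t = - (1 - x / L).
Proof.
move=> /andP[t0 tx].
have [|_ ->//] := slope_bwd_affine (m := 1 - x / L) (k := 0)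
  tent_cpa (lexx _) t0 (le_trans tx (ltW x_ltL)).
move=> s /andP[s0 st]; apply: tent_left.
by rewrite (ltW s0) (le_trans (ltW st)).
Qed.

Lemma tent_slope_bwd_right t : x < t <= L -> slope_bwd tent e0 t = x / L.
Proof.
move=> /andP[xt tL].
have [|_ ->//] := slope_bwd_affine (m := - (x / L)) (k := x)
  tent_cpa (ltW x_gt0) xt tL; last by rewrite opprK.
move=> s /andP[xs st]; apply: tent_right.
by rewrite (ltW xs) (le_trans (ltW st)).
Qed.

Lemma tent_slope_fwd_off e t : e != e0 -> 0 <= t < len e ->
  slope_fwd tent e t = 0.
Proof.
move=> ee0 /andP[t0 te].
have [|_ ->//] := slope_fwd_affine (m := 0) (k := 0) tent_cpa t0 te (lexx _).
move=> s /andP[ts se]; rewrite tent_off// ?mul0r ?addr0//.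
by rewrite (le_trans t0 (ltW ts)) ltW.
Qed.

Lemma tent_slope_bwd_off e t : e != e0 -> 0 < t <= len e ->
  slope_bwd tent e t = 0.
Proof.
move=> ee0 /andP[t0 te].
have [|_ ->//] := slope_bwd_affine (m := 0) (k := 0) tent_cpa (lexx _) t0 te.
  move=> s /andP[s0 st]; rewrite tent_off// ?mul0r ?addr0//.
  by rewrite (ltW s0) (le_trans (ltW st)).
by rewrite oppr0.
Qed.

(** At the apex the outgoing slopes [- (x / L)] and [- (1 - x / L)] add up to -1. The slopes into
    the edge at its ends are [1 - x / L] and [x / L], which give the negative masses there. *)
Lemma tent_laplacian p :
  laplacian tent p = point_mass (edge_point e0 x) p
    - ((1 - x / L) * point_mass (vertex_point (src e0)) p
       + x / L * point_mass (vertex_point (tgt e0)) p).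
Proof.
rewrite (edge_point_interior hx) /laplacian /point_mass.
case: p => [v|[[e t] /= te]] /=.
  have massE a : ((inl v : Defs.point G) == vertex_point a) = (a == v).
    by rewrite eq_sym.
  rewrite !massE sub0r big_mkcond (bigD1 e0)//= [X in _ + X + _]big1; last first.
    move=> e ee0; rewrite tent_slope_fwd_off ?if_same//.
    by rewrite lexx len_gt0.
  rewrite [X in _ + _ + X]big_mkcond (bigD1 e0)//= [X in _ + (_ + X)]big1; last first.
    move=> e ee0; rewrite tent_slope_bwd_off ?if_same//.
    by rewrite lexx len_gt0.
  rewrite tent_slope_fwd_left ?lexx// tent_slope_bwd_right ?lexx ?andbT//.
  (* The case where both tests hold is that of a self-loop, whose two end masses fall on one
     vertex. *)
  by do 2!case: (_ == v); rewrite /=; ring.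
rewrite !mulr0 addr0 subr0; case/andP: (te) => t0 tL.
rewrite -[_ == _]/((e, t) == (e0, x)) xpair_eqE.
have [eE|ee0] := eqVneq e e0; last first.
  by rewrite tent_slope_fwd_off ?tent_slope_bwd_off ?t0 ?tL ?ltW//= addr0 oppr0.
move: tL; rewrite eE => tL; rewrite /=; have [tx|xt|->] := ltgtP t x.
- rewrite tent_slope_fwd_left ?tent_slope_bwd_left ?t0 ?tx ?ltW//=; ring.
- rewrite tent_slope_fwd_right ?tent_slope_bwd_right ?xt ?tL ?(ltW tL) ?(ltW xt)//=; ring.
- rewrite tent_slope_fwd_right ?tent_slope_bwd_left ?lexx ?x_gt0 ?x_ltL//=; ring.
Qed.

End Tent.

(** * The resistance along an edge *)

Theorem lemma3p2 (R : realType) (G : metrized_graph R)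
    (e : edge G) (x : R) (hx : 0 <= x <= len e) (p : vertex G) :
  let L := len e in
  let r := @resistance R G in
  let p_i := vertex_point (src e) in
  let q_i := vertex_point (tgt e) in
  r (vertex_point p) (edge_point e x) =
    - x ^+ 2 * ((L - r p_i q_i) / L ^+ 2)
    + x * ((L - r p_i q_i + r (vertex_point p) q_i - r (vertex_point p) p_i) / L)
    + r (vertex_point p) p_i.
Proof.
move=> L r p_i q_i; have L0 : L != 0 by rewrite gt_eqF// len_gt0.
(* The tent needs an interior apex. At the parameters 0 and [L] the right-hand side reduces directly
   to [r(p, p_i)] and [r(p, q_i)]. *)
case/andP: hx; rewrite le_eqVlt => /predU1P[<- _|x0].
  by rewrite edge_point_src -/(vertex_point _) -/p_i; ring.
rewrite le_eqVlt => /predU1P[->|xL].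
  by rewrite edge_point_tgt -/(vertex_point _) -/q_i -/L; field.
have hx : 0 < x < len e by rewrite x0.
have potential (a : vertex G) : exists u, forall v,
    discrete_laplacian u v = (v == p)%:R - (v == a)%:R.
  apply: discrete_poisson; rewrite sumrB.
  have sum1 (b : vertex G) : \sum_v (v == b)%:R = 1 :> R.
    by rewrite (bigD1 b)//= eqxx big1 ?addr0// => v /negPf->.
  by rewrite !sum1 subrr.
have [u uE] := potential (src e); have [w wE] := potential (tgt e).
pose U := affine_extension u; pose W := affine_extension w.
have cU : continuous_piecewise_affine U := edge_affine_cpa (affine_extensionP u).
have cW : continuous_piecewise_affine W := edge_affine_cpa (affine_extensionP w).
have LU q : laplacian U q = point_mass (vertex_point p) q - point_mass p_i q.
  case: q => [v|z]; last first.
    by rewrite (edge_affine_laplacian_interior _ (affine_extensionP u)) subrr.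
  by rewrite (edge_affine_laplacian_vertex _ (affine_extensionP u)) uE.
have LW q : laplacian W q = point_mass (vertex_point p) q - point_mass q_i q.
  case: q => [v|z]; last first.
    by rewrite (edge_affine_laplacian_interior _ (affine_extensionP w)) subrr.
  by rewrite (edge_affine_laplacian_vertex _ (affine_extensionP w)) wE.
have rpp : r (vertex_point p) p_i = U (vertex_point p) - U p_i.
  exact: resistanceE.
have rpq : r (vertex_point p) q_i = W (vertex_point p) - W q_i.
  exact: resistanceE.
(* In the difference of the Laplacians of [W] and [U] the mass at [p] cancels, leaving a unit
   current from [p_i] to [q_i]. *)
have rpiqi : r p_i q_i = (W p_i + -1 * U p_i) - (W q_i + -1 * U q_i).
  apply: (resistanceE (f := fun q => W q + -1 * U q)); first exact: cpa_linear.
  by move=> q; rewrite laplacian_linear// LU LW; ring.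
(* The unit current leaving at x is split between the end points in the        *)
(* proportion (1 - x / L) : x / L, and the tent moves it from there to x.      *)
pose f q := U q + x / L * (W q + -1 * U q) + -1 * tent e x q.
have cf0 : continuous_piecewise_affine (fun q => U q + x / L * (W q + -1 * U q)).
  exact: cpa_linear cU (cpa_linear (-1) cW cU).
have -> : r (vertex_point p) (edge_point e x) =
    f (vertex_point p) - f (edge_point e x).
  apply: resistanceE; first exact: cpa_linear cf0 (tent_cpa hx).
  move=> q; rewrite (laplacian_linear _ _ cf0 (tent_cpa hx)).
  rewrite (laplacian_linear _ _ cU (cpa_linear (-1) cW cU)).
  rewrite (laplacian_linear _ _ cW cU) LU LW tent_laplacian//.
  by rewrite -/p_i -/q_i -/L; ring.
have xL' : 0 <= x <= len e by rewrite !ltW.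
(* [U] and [W] are interpolated at [x], where the tent has height [(1 - x / L) * x]. With
   [s = x / L] the drop is [(1 - s) r(p, p_i) + s r(p, q_i) + s (1 - s) (L - r(p_i, q_i))]. *)
rewrite /f /U /W (affine_extensionP u xL') (affine_extensionP w xL').
rewrite (tent_left hx) ?lexx ?ltW//= rpp rpq rpiqi /U /W /= -/L.
by field.
Qed.
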